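(* If $\mathcal{N}$ is an entanglement-breaking quantum channel, then $\mathrm{cv}(\mathcal{N}\otimes\mathcal{M})=\mathrm{cv}(\mathcal{N})\,\mathrm{cv}(\mathcal{M})$ for an arbitrary quantum channel $\mathcal{M}$.
   Context: All Hilbert spaces are finite-dimensional; a quantum channel is a CPTP map. A channel $\mathcal{N}$ from $A$ to $B$ is entanglement-breaking if $(\mathcal{N}\otimes\mathrm{id}^C)(\rho^{AC})$ is a separable operator on $\mathcal{H}^B\otimes\mathcal{H}^C$ (a non-negative combination of products of pure states) for every system $C$ and every positive semidefinite $\rho^{AC}$. Communication value: for a classical channel with transition probabilities $P(y|x)$, $x\in[n]$, $y\in[n']$, put $\mathrm{cv}(\mathbf{P})=\sum_{y\in[n']}\max_{x\in[n]}P(y|x)$. For a quantum channel, $\mathrm{cv}(\mathcal{N})$ is the supremum, over all $n,n'\in\mathbb{N}$, all density operators $\rho_1,\dots,\rho_n$ on the input space and all POVMs $\{\Pi_y\}_{y=1}^{n'}$ on the output space, of $\mathrm{cv}(\mathbf{P})$ with $P(y|x)=\mathrm{Tr}[\Pi_y\mathcal{N}(\rho_x)]$. For a tensor product channel, arbitrary (possibly entangled) states and joint POVMs on the composite input and output spaces are allowed. *)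

(* Defs.v *)
From HB Require Import structures.
From mathcomp Require Import all_boot all_order all_algebra.
From mathcomp Require Import complex mxtens.
From mathcomp Require Import boolp classical_sets reals.

Set Implicit Arguments.
Unset Strict Implicit.
Unset Printing Implicit Defensive.

Import Order.TTheory GRing.Theory Num.Theory.
Local Open Scope ring_scope.

(* A Hilbert space of dimension n is C^n, so its operators are 'M[R[i]]_n; the
   tensor product of C^m and C^n is C^(m * n), with tensmx ( *t ) as the
   Kronecker product. *)

Definition adjmx (R : rcfType) m n (A : 'M[R[i]]_(m, n)) : 'M[R[i]]_(n, m) :=
  map_mx Num.conj A^T.

(* The order of R[i] compares only numbers with the same imaginary part, so
   0 <= z says that z is real and nonnegative; over the complex numbers this
   makes A Hermitian. *)
Definition psdmx (R : rcfType) n (A : 'M[R[i]]_n) : Prop :=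
  forall v : 'cV[R[i]]_n, 0 <= (adjmx v *m A *m v) 0 0.

Definition density (R : rcfType) n (rho : 'M[R[i]]_n) : Prop :=
  psdmx rho /\ \tr rho = 1.

Definition pure_state (R : rcfType) n (P : 'M[R[i]]_n) : Prop :=
  exists2 v : 'cV[R[i]]_n, (adjmx v *m v) 0 0 = 1 & P = v *m adjmx v.

Definition povm (R : rcfType) n k (E : 'I_k -> 'M[R[i]]_n) : Prop :=
  (forall y, psdmx (E y)) /\ \sum_(y < k) E y = 1%:M.

(* The unique linear map sending A *t B to N A *t M B (see tensmapE), given on
   the basis of the products delta_mx i j *t delta_mx k l. *)
Definition tensmap (K : comNzRingType) a b c d
    (N : {linear 'M[K]_a -> 'M[K]_b}) (M : {linear 'M[K]_c -> 'M[K]_d})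
    (X : 'M[K]_(a * c)) : 'M[K]_(b * d) :=
  \sum_(i < a) \sum_(j < a) \sum_(k < c) \sum_(l < c)
    X (mxtens_index (i, k)) (mxtens_index (j, l)) *:
      (N (delta_mx i j) *t M (delta_mx k l)).

Fact tensmap_is_linear (K : comNzRingType) a b c d
    (N : {linear 'M[K]_a -> 'M[K]_b}) (M : {linear 'M[K]_c -> 'M[K]_d}) :
  linear (tensmap N M).
Proof.
move=> t X Y; rewrite /tensmap.
do 4! [rewrite scaler_sumr -big_split; apply: eq_bigr => ? _ /=].
by rewrite !mxE scalerDl scalerA.
Qed.

HB.instance Definition _ (K : comNzRingType) a b c d
    (N : {linear 'M[K]_a -> 'M[K]_b}) (M : {linear 'M[K]_c -> 'M[K]_d}) :=
  GRing.isLinear.Build K 'M[K]_(a * c) 'M[K]_(b * d) *:%R (tensmap N M)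
    (tensmap_is_linear N M).

Lemma tensmapE (K : comNzRingType) a b c d
    (N : {linear 'M[K]_a -> 'M[K]_b}) (M : {linear 'M[K]_c -> 'M[K]_d}) A B :
  tensmap N M (A *t B) = N A *t M B.
Proof.
rewrite [in RHS](matrix_sum_delta A) [in RHS](matrix_sum_delta B) !linear_sum.
apply/matrixP => r s.
case: (mxtens_indexP r) => r1 r2; case: (mxtens_indexP s) => s1 s2.
rewrite tensmxE !summxE mulr_suml; apply: eq_bigr => i _.
rewrite linear_sum !summxE mulr_suml; apply: eq_bigr => j _.
rewrite summxE mulr_sumr; apply: eq_bigr => k _.
rewrite linear_sum !summxE mulr_sumr; apply: eq_bigr => l _.
by rewrite mxE !tensmxE !linearZ !mxE mulrACA.
Qed.

Section Channels.
Variables (R : rcfType) (a b : nat).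
Implicit Type N : {linear 'M[R[i]]_a -> 'M[R[i]]_b}.

Definition completely_positive N : Prop :=
  forall (c : nat) (rho : 'M[R[i]]_(a * c)),
    psdmx rho -> psdmx (tensmap N (idfun : {linear _ -> 'M[R[i]]_c}) rho).

Definition trace_preserving N : Prop := forall A, \tr (N A) = \tr A.

Definition quantum_channel N : Prop :=
  completely_positive N /\ trace_preserving N.

Definition separable (X : 'M[R[i]]_(a * b)) : Prop :=
  exists (k : nat) (p : 'I_k -> R)
         (P : 'I_k -> 'M[R[i]]_a) (Q : 'I_k -> 'M[R[i]]_b),
    [/\ forall j, 0 <= p j, forall j, pure_state (P j),
        forall j, pure_state (Q j) &
        X = \sum_(j < k) (p j)%:C%C *: (P j *t Q j)].

End Channels.

Definition entanglement_breaking (R : rcfType) a b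
    (N : {linear 'M[R[i]]_a -> 'M[R[i]]_b}) : Prop :=
  forall (c : nat) (rho : 'M[R[i]]_(a * c)),
    psdmx rho -> separable (tensmap N (idfun : {linear _ -> 'M[R[i]]_c}) rho).

(* P x y is the transition probability P(y|x).  Probabilities are nonnegative,
   so the default value 0 does not affect the maximum over x when 0 < n. *)
Definition classical_cv (R : realType) n n' (P : 'I_n -> 'I_n' -> R) : R :=
  \sum_(y < n') \big[Num.max/0]_(x < n) P x y.

(* The trace is real, so Re only moves it from R[i] to R. *)
Definition transition (R : realType) a b
    (N : {linear 'M[R[i]]_a -> 'M[R[i]]_b}) n n'
    (rho : 'I_n -> 'M[R[i]]_a) (E : 'I_n' -> 'M[R[i]]_b) (x : 'I_n) (y : 'I_n')
  : R := complex.Re (\tr (E y *m N (rho x))).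

(* For a channel the set is bounded above by b, since the trace of E y times a
   density operator is at most the trace of E y; so sup is a genuine supremum
   as soon as density operators exist, i.e. a > 0.  When a = 0 the set is empty
   and cv N = 0. *)
Definition cv (R : realType) a b
    (N : {linear 'M[R[i]]_a -> 'M[R[i]]_b}) : R :=
  sup [set r : R | exists (n n' : nat)
        (rho : 'I_n -> 'M[R[i]]_a) (E : 'I_n' -> 'M[R[i]]_b),
        [/\ (0 < n)%N, forall x, density (rho x), povm E &
            r = classical_cv (transition N rho E)]]%classic.

(* Main.v *)
Require Import Defs.
From HB Require Import structures.
From mathcomp Require Import all_boot all_order all_algebra.
From mathcomp Require Import complex mxtens reals.
From mathcomp Require Import boolp classical_sets.
From mathcomp Require Import ring lra.

(** The lower bound is attained by product protocols.  For the upper bound, the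
dual description of the communication value is used: up to an arbitrarily small
error, [cv M] is the trace of an operator [Z] that dominates [M sigma] for every
state [sigma].  Such a [Z] is found by perturbing the measurement of a nearly
optimal protocol, which avoids both compactness and a minimax theorem.  If [N]
is entanglement-breaking, [(N (x) id) rho] is a mixture of products
[P_j (x) Q_j], so
  [(N (x) M) rho = \sum_j p_j (P_j (x) M Q_j) <= N (Tr_C rho) (x) Z],
and the right-hand side is [\tr Z] times [N (Tr_C rho)] together with a fixed
state, which no joint measurement can exploit beyond [cv N]. *)

Import Order.TTheory GRing.Theory Num.Theory.
Local Open Scope ring_scope.

Set Implicit Arguments.
Unset Strict Implicit.
Unset Printing Implicit Defensive.

(** * Adjoints, positive semidefinite matrices and density operators *)

Section PositiveSemidefinite.
Variable R : rcfType.
Local Notation C := R[i].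

Lemma adjmxE m n (A : 'M[C]_(m, n)) i j : adjmx A i j = (A j i)^*.
Proof. by rewrite !mxE. Qed.

Lemma adjmxK m n (A : 'M[C]_(m, n)) : adjmx (adjmx A) = A.
Proof. by apply/matrixP => i j; rewrite !mxE conjCK. Qed.

Lemma adjmxM m n p (A : 'M[C]_(m, n)) (B : 'M[C]_(n, p)) :
  adjmx (A *m B) = adjmx B *m adjmx A.
Proof. by rewrite /adjmx trmx_mul map_mxM. Qed.

Lemma adjmxB m n (A B : 'M[C]_(m, n)) : adjmx (A - B) = adjmx A - adjmx B.
Proof. by apply/matrixP => i j; rewrite !mxE rmorphB. Qed.

Lemma adjmxZ m n t (A : 'M[C]_(m, n)) : adjmx (t *: A) = t^* *: adjmx A.
Proof. by apply/matrixP => i j; rewrite !mxE rmorphM. Qed.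

Lemma adjmx1 n : adjmx 1%:M = 1%:M :> 'M[C]_n.
Proof. by rewrite /adjmx trmx1 map_mx1. Qed.

Lemma adjmx_tens m n p q (A : 'M[C]_(m, n)) (B : 'M[C]_(p, q)) :
  adjmx (A *t B) = adjmx A *t adjmx B.
Proof. by rewrite /adjmx trmx_tens map_mxT. Qed.

Lemma tr_adjmx n (A : 'M[C]_n) : \tr (adjmx A) = (\tr A)^*.
Proof.
by rewrite /mxtrace rmorph_sum; apply: eq_bigr => i _; rewrite adjmxE.
Qed.

Lemma mxtrace_tens m n (A : 'M[C]_m) (B : 'M[C]_n) :
  \tr (A *t B) = \tr A * \tr B.
Proof. by rewrite /mxtrace mulr_sum; apply: eq_bigr => i _; rewrite mxE. Qed.

Lemma form_mxE n (A : 'M[C]_n) (v w : 'cV[C]_n) :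
  (adjmx v *m A *m w) 0 0 = \tr (A *m (w *m adjmx v)).
Proof. by rewrite -trace_mx11 -mulmxA mxtrace_mulC -mulmxA. Qed.

Lemma normv_ge0 n (v : 'cV[C]_n) : 0 <= (adjmx v *m v) 0 0.
Proof.
by rewrite mxE sumr_ge0 // => i _; rewrite adjmxE mulrC mul_conjC_ge0.
Qed.

Lemma normv_eq0 n (v : 'cV[C]_n) : (adjmx v *m v) 0 0 = 0 -> v = 0.
Proof.
rewrite mxE => /eqP; rewrite psumr_eq0; last first.
  by move=> i _; rewrite adjmxE mulrC mul_conjC_ge0.
move=> /allP v0; apply/colP => i; rewrite mxE.
have := v0 i (mem_index_enum i).
by rewrite adjmxE mulrC mul_conjC_eq0 => /eqP.
Qed.

Lemma psdmx_gram m n (W : 'M[C]_(m, n)) : psdmx (W *m adjmx W).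
Proof.
move=> v; have -> : adjmx v *m (W *m adjmx W) *m v
  = adjmx (adjmx W *m v) *m (adjmx W *m v) by rewrite adjmxM adjmxK !mulmxA.
exact: normv_ge0.
Qed.

Lemma psdmx1 n : psdmx (1%:M : 'M[C]_n).
Proof. by rewrite -[1%:M]mulmx1 -{2}adjmx1; apply: psdmx_gram. Qed.

Lemma psdmx0 n : psdmx (0 : 'M[C]_n).
Proof. by move=> v; rewrite mulmx0 mul0mx mxE. Qed.

Lemma psdmxD n (A B : 'M[C]_n) : psdmx A -> psdmx B -> psdmx (A + B).
Proof. by move=> pA pB v; rewrite mulmxDr mulmxDl mxE addr_ge0. Qed.

Lemma psdmxZ n t (A : 'M[C]_n) : 0 <= t -> psdmx A -> psdmx (t *: A).
Proof. by move=> t0 pA v; rewrite -scalemxAr -scalemxAl mxE mulr_ge0. Qed.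

Lemma psdmx_sum n (I : Type) (r : seq I) (P : pred I) (F : I -> 'M[C]_n) :
  (forall i, P i -> psdmx (F i)) -> psdmx (\sum_(i <- r | P i) F i).
Proof.
by move=> pF; elim/big_ind: _ => //; [apply: psdmx0 | apply: psdmxD].
Qed.

Lemma psdmx_conj m n (B : 'M[C]_(m, n)) (A : 'M[C]_n) :
  psdmx A -> psdmx (B *m A *m adjmx B).
Proof.
move=> pA v; have := pA (adjmx B *m v).
by rewrite adjmxM adjmxK !mulmxA.
Qed.

Lemma psdmx_diag n (A : 'M[C]_n) i : psdmx A -> 0 <= A i i.
Proof.
move=> /(_ (delta_mx i 0)).
have -> : adjmx (delta_mx i 0) = delta_mx 0 i :> 'rV[C]_n.
  by apply/rowP => j; rewrite !mxE eqxx /= andbT conjC_nat.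
by rewrite -rowE -colE !mxE.
Qed.

Lemma psdmx_tr_ge0 n (A : 'M[C]_n) : psdmx A -> 0 <= \tr A.
Proof. by move=> pA; rewrite sumr_ge0 // => i _; apply: psdmx_diag. Qed.

(** Polarization: the form of [D = adjmx A - A] vanishes on every vector. On [e_i + t e_j] this
    gives [t * D i j + t^* * D j i = 0], and [t = 1] together with [t = 'i] forces [D i j = 0]. *)
Lemma psdmx_adj n (A : 'M[C]_n) : psdmx A -> adjmx A = A.
Proof.
move=> pA; apply/eqP; rewrite -subr_eq0.
pose D : 'M[C]_n := adjmx A - A; rewrite -/D.
have D0 (v : 'cV_n) : (adjmx v *m D *m v) 0 0 = 0.
  rewrite /D mulmxBr mulmxBl mxE [X in _ + X]mxE.
  have -> : adjmx v *m adjmx A *m v = adjmx (adjmx v *m A *m v).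
    by rewrite !adjmxM adjmxK mulmxA.
  by rewrite adjmxE conj_Creal ?subrr //; apply/ger0_real/pA.
have Dii i : D i i = 0.
  by rewrite /D !mxE conj_Creal ?subrr // ger0_real //; apply: psdmx_diag.
clearbody D; have Dt i j t : t * D i j + t^* * D j i = 0.
  pose v : 'cV[C]_n := delta_mx i 0 + t *: delta_mx j 0.
  have av : adjmx v = delta_mx 0 i + t^* *: delta_mx 0 j.
    by apply/rowP => k; rewrite !mxE !eqxx !andbT rmorphD rmorphM /= !conjC_nat.
  have := D0 v; rewrite av mulmxDl -scalemxAl -!rowE mulmxDr !mulmxDl.
  rewrite -!scalemxAr -!scalemxAl -!colE !mxE !Dii !mulr0 add0r addr0.
  by rewrite addrC.
apply/eqP/matrixP => i j; rewrite [RHS]mxE.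
have := Dt i j 1; have := Dt i j 'i; rewrite conjC1 !mul1r conjCi mulNr.
move=> /eqP; rewrite subr_eq0 => /eqP/(mulfI (neq0Ci _)) -> /eqP.
by rewrite -mulr2n mulrn_eq0 => /eqP.
Qed.

(** By the spectral theorem [A = adjmx P *m diag_mx D *m P] with [P] unitary and [D] nonnegative, so
    [adjmx P] times the square root of the diagonal serves as [W]. *)
Lemma psdmx_sqrt n (A : 'M[C]_n) :
  psdmx A -> exists W : 'M[C]_n, A = W *m adjmx W.
Proof.
move=> pA; have /orthomx_spectralP : A \is normalmx.
  apply: hermitian_normalmx; apply/is_hermitianmxP.
  by rewrite expr0 scale1r -{1}(psdmx_adj pA).
set P := spectralmx A; set D := spectral_diag A.
have PU : P \is unitarymx := spectral_unitarymx A.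
rewrite invmx_unitary // -/(adjmx P) => eqA.
have PP : P *m adjmx P = 1%:M by apply/unitarymxP.
have D_ge0 i : 0 <= D 0 i.
  have := psdmx_diag i (psdmx_conj P pA).
  rewrite eqA !mulmxA PP mul1mx -mulmxA PP mulmx1 mxE eqxx mulr1n.
  by [].
pose S := diag_mx (map_mx sqrtC D).
have adjS : adjmx S = S.
  apply/matrixP => i j; rewrite !mxE rmorphMn /= eq_sym.
  case: eqP => [->|_]; last by rewrite !mulr0n.
  by rewrite conj_Creal // ger0_real // sqrtC_ge0.
exists (adjmx P *m S); rewrite adjmxM adjmxK adjS {1}eqA !mulmxA.
congr (_ *m _); rewrite -!mulmxA; congr (_ *m _).
rewrite mulmx_diag; congr diag_mx; apply/rowP => i.
by rewrite !mxE -expr2 sqrtCK.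
Qed.

Lemma tr_psdmxM_ge0 n (A B : 'M[C]_n) : psdmx A -> psdmx B -> 0 <= \tr (A *m B).
Proof.
move=> /psdmx_sqrt[W ->] pB; rewrite -mulmxA mxtrace_mulC.
by have := psdmx_tr_ge0 (psdmx_conj (adjmx W) pB); rewrite adjmxK.
Qed.

Lemma psdmx_tens m n (A : 'M[C]_m) (B : 'M[C]_n) :
  psdmx A -> psdmx B -> psdmx (A *t B).
Proof.
move=> /psdmx_sqrt[V ->] /psdmx_sqrt[W ->].
by rewrite -tensmx_mul -adjmx_tens; apply: psdmx_gram.
Qed.

(** Quadratic forms scale by a nonnegative factor. On unit vectors [v *m adjmx v] is a projection,
    which the later estimates use. *)
Lemma psdmx_unit n (A : 'M[C]_n) :
  (forall v : 'cV_n, (adjmx v *m v) 0 0 = 1 -> 0 <= (adjmx v *m A *m v) 0 0) ->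
  psdmx A.
Proof.
move=> uA v; have [v0|v0] := eqVneq ((adjmx v *m v) 0 0) 0.
  by rewrite (normv_eq0 v0) mulmx0 mxE.
pose s := sqrtC ((adjmx v *m v) 0 0).
have s_ge0 : 0 <= s by rewrite sqrtC_ge0 normv_ge0.
have s0 : s != 0 by rewrite sqrtC_eq0.
have sC : s^* = s by rewrite conj_Creal // ger0_real.
pose w := s^-1 *: v; have -> : v = s *: w by rewrite scalerA mulfV ?scale1r.
have w1 : (adjmx w *m w) 0 0 = 1.
  rewrite /w adjmxZ -scalemxAr -scalemxAl 2!mxE.
  by rewrite fmorphV /= sC mulrA -invfM -expr2 sqrtCK mulVf.
rewrite adjmxZ sC -scalemxAr -2!scalemxAl 2!mxE !mulr_ge0 //.
exact: uA.
Qed.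

Lemma density_pure n (P : 'M[C]_n) : pure_state P -> density P.
Proof.
move=> [v v1 ->]; split; first exact: psdmx_gram.
by rewrite mxtrace_mulC trace_mx11.
Qed.

Lemma proj_idem n (v : 'cV[C]_n) : (adjmx v *m v) 0 0 = 1 ->
  v *m adjmx v *m (v *m adjmx v) = v *m adjmx v.
Proof.
move=> v1; rewrite mulmxA -[v *m _ *m v]mulmxA [_ *m v]mx11_scalar v1.
by rewrite mulmx1.
Qed.

(** The complement [1 - K] of a projection is a self-adjoint idempotent, hence a Gram matrix, so its
    trace against [rho] is nonnegative. *)
Lemma tr_proj_density_le1 n (rho : 'M[C]_n) (v : 'cV[C]_n) :
  density rho -> (adjmx v *m v) 0 0 = 1 ->
  \tr (rho *m (v *m adjmx v)) <= 1.
Proof.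
move=> [prho tr1] v1; rewrite -tr1 -subr_ge0 -raddfB -{1}[rho]mulmx1 -mulmxBr.
apply: tr_psdmxM_ge0 => //; set K := v *m adjmx v.
have KK : K *m K = K by apply: proj_idem.
have -> : 1%:M - K = (1%:M - K) *m adjmx (1%:M - K).
  have -> : adjmx (1%:M - K) = 1%:M - K by rewrite adjmxB adjmx1 adjmxM adjmxK.
  by rewrite mulmxBr mulmx1 mulmxBl mul1mx KK subrr subr0.
exact: psdmx_gram.
Qed.

Lemma density_le1 n (rho : 'M[C]_n) : density rho -> psdmx (1%:M - rho).
Proof.
move=> drho; apply: psdmx_unit => v v1.
rewrite mulmxBr mulmxBl mulmx1 mxE v1 mxE subr_ge0 form_mxE.
exact: tr_proj_density_le1.
Qed.

Lemma density_delta n : density (delta_mx 0 0 : 'M[C]_n.+1).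
Proof.
apply: density_pure; exists (delta_mx 0 0).
  rewrite /adjmx trmx_delta map_delta_mx mul_delta_mx mxE //.
by rewrite /adjmx trmx_delta map_delta_mx mul_delta_mx.
Qed.

Lemma density_tens m n (A : 'M[C]_m) (B : 'M[C]_n) :
  density A -> density B -> density (A *t B).
Proof.
move=> [pA tA] [pB tB]; split; first exact: psdmx_tens.
by rewrite mxtrace_tens tA tB mulr1.
Qed.

End PositiveSemidefinite.

(** * Tensor products of maps and the partial trace *)

Section PartialTrace.
Variable K : comNzRingType.

Lemma tensmx11 m n : 1%:M *t 1%:M = 1%:M :> 'M[K]_(m * n).
Proof.
apply/matrixP => i j; case: (mxtens_indexP i) => i1 i2.
case: (mxtens_indexP j) => j1 j2.
rewrite tensmxE !mxE -natrM mulnb (inj_eq (can_inj (@mxtens_indexK m n))).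
by rewrite xpair_eqE.
Qed.

Lemma sum_mxtens (V : nmodType) m n (F : 'I_(m * n) -> V) :
  \sum_p F p = \sum_i \sum_j F (mxtens_index (i, j)).
Proof.
rewrite pair_big (reindex (@mxtens_index m n)) //=.
  by apply: eq_bigr => -[].
by exists (@mxtens_unindex m n) => p _;
  rewrite (mxtens_indexK, mxtens_unindexK).
Qed.

Lemma tensmxDl m n p q (A B : 'M[K]_(m, n)) (X : 'M[K]_(p, q)) :
  (A + B) *t X = A *t X + B *t X.
Proof. by apply/matrixP => i j; rewrite !mxE mulrDl. Qed.

Lemma tensmxBr m n p q (A : 'M[K]_(m, n)) (X Y : 'M[K]_(p, q)) :
  A *t (X - Y) = A *t X - A *t Y.
Proof. by apply/matrixP => i j; rewrite !mxE mulrBr. Qed.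

Lemma tensmxZl m n p q t (A : 'M[K]_(m, n)) (X : 'M[K]_(p, q)) :
  (t *: A) *t X = t *: (A *t X).
Proof. by apply/matrixP => i j; rewrite !mxE mulrA. Qed.

Lemma tensmx_suml m n p q (I : Type) (r : seq I) (P : pred I)
    (F : I -> 'M[K]_(m, n)) (X : 'M[K]_(p, q)) :
  (\sum_(i <- r | P i) F i) *t X = \sum_(i <- r | P i) F i *t X.
Proof.
by elim/big_rec2: _ => [|i _ B _ <-]; rewrite ?tens0mx ?tensmxDl.
Qed.

Lemma tensmx_sumr m n p q (I : Type) (r : seq I) (P : pred I)
    (X : 'M[K]_(p, q)) (F : I -> 'M[K]_(m, n)) :
  X *t (\sum_(i <- r | P i) F i) = \sum_(i <- r | P i) X *t F i.
Proof.
elim/big_rec2: _ => [|i _ B _ <-]; first by rewrite tensmx0.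
by apply/matrixP => u v; rewrite !mxE mulrDr.
Qed.

(** Isolates the factor [N (x) id], the only one about which entanglement-breaking says anything. *)
Lemma tensmap_comp a b c d (N : {linear 'M[K]_a -> 'M[K]_b})
    (M : {linear 'M[K]_c -> 'M[K]_d}) X :
  tensmap N M X = tensmap idfun M (tensmap N idfun X).
Proof.
rewrite [tensmap N idfun X]/tensmap.
do 4! [rewrite linear_sum; apply: eq_bigr => ? _].
by rewrite linearZ /= tensmapE.
Qed.

Lemma mxtrace_delta n (i j : 'I_n) : \tr (delta_mx i j : 'M[K]_n) = (i == j)%:R.
Proof.
rewrite /mxtrace (bigD1 i) //= big1 => [|k /negPf ki]; rewrite !mxE ?ki //.
by rewrite eqxx addr0.
Qed.

(** The partial trace over the second factor, written as a sum of principal submatrices so that it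
    visibly preserves positivity. *)
Definition ptrace a c (X : 'M[K]_(a * c)) : 'M[K]_a :=
  \sum_k mxsub (fun i => mxtens_index (i, k)) (fun i => mxtens_index (i, k)) X.

Lemma ptraceE a c (X : 'M[K]_(a * c)) i j :
  ptrace X i j = \sum_k X (mxtens_index (i, k)) (mxtens_index (j, k)).
Proof. by rewrite summxE; apply: eq_bigr => k _; rewrite mxE. Qed.

Fact ptrace_is_linear a c : linear (@ptrace a c).
Proof.
move=> t X Y; apply/matrixP => i j; rewrite 2!mxE !ptraceE mulr_sumr -big_split.
by apply: eq_bigr => k _; rewrite !mxE.
Qed.

HB.instance Definition _ a c :=
  GRing.isLinear.Build K 'M[K]_(a * c) 'M[K]_a *:%R (@ptrace a c)
    (@ptrace_is_linear a c).

Lemma mxtrace_ptrace a c (X : 'M[K]_(a * c)) : \tr (ptrace X) = \tr X.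
Proof.
by rewrite /mxtrace sum_mxtens; apply: eq_bigr => i _; rewrite ptraceE.
Qed.

Lemma ptrace_tens a c (A : 'M[K]_a) (B : 'M[K]_c) :
  ptrace (A *t B) = \tr B *: A.
Proof.
apply/matrixP => i j; rewrite ptraceE mxE mulr_suml.
by apply: eq_bigr => k _; rewrite tensmxE mulrC.
Qed.

(** After taking traces, this makes [ptrace] dual to [X |-> X *t 1] for the trace pairing. *)
Lemma ptrace_mulr a c (Y : 'M[K]_(a * c)) (X : 'M[K]_a) :
  ptrace (Y *m (X *t 1%:M)) = ptrace Y *m X.
Proof.
apply/matrixP => i j; rewrite ptraceE mxE.
under [RHS]eq_bigr => l _ do rewrite ptraceE mulr_suml.
rewrite exchange_big; apply: eq_bigr => k _; rewrite mxE sum_mxtens.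
apply: eq_bigr => l _; rewrite (bigD1 k) //= big1 ?addr0 => [|k' /negPf k'k].
  by rewrite tensmxE mxE eqxx mulr1.
by rewrite tensmxE mxE k'k !mulr0.
Qed.

(** Only diagonal units [delta_mx k k] of the second factor have nonzero trace, so only the blocks
    making up [ptrace X] survive. *)
Lemma ptrace_tensmap a b c (N : {linear 'M[K]_a -> 'M[K]_b})
    (X : 'M[K]_(a * c)) :
  ptrace (tensmap N (idfun : {linear _ -> 'M[K]_c}) X) = N (ptrace X).
Proof.
rewrite [in RHS](matrix_sum_delta (ptrace X)) /tensmap.
do 2! [rewrite !linear_sum; apply: eq_bigr => ? _].
rewrite [RHS]linearZ /= ptraceE scaler_suml ?linear_sum; apply: eq_bigr => k _.
rewrite linear_sum (bigD1 k) //= big1 ?addr0 => [|l /negPf lk].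
  by rewrite linearZ /= ptrace_tens mxtrace_delta eqxx scale1r.
by rewrite linearZ /= ptrace_tens mxtrace_delta eq_sym lk scale0r scaler0.
Qed.

End PartialTrace.

(** * Positivity of channels, entanglement-breaking domination and reduced measurements *)

Section PositiveMaps.
Variable R : rcfType.
Local Notation C := R[i].

Lemma psdmx_mxsub m n (f : 'I_m -> 'I_n) (A : 'M[C]_n) :
  psdmx A -> psdmx (mxsub f f A).
Proof.
move=> pA; have -> : mxsub f f A = rowsub f 1%:M *m A *m adjmx (rowsub f 1%:M).
  apply/matrixP => i j; rewrite mul_rowsub_mx mul1mx.
  rewrite !mxE (bigD1 (f j)) //= big1 => [|k /negPf kf].
    by rewrite !mxE eqxx rmorph1 mulr1 addr0.
  by rewrite !mxE eq_sym kf rmorph0 mulr0.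
exact: psdmx_conj.
Qed.

Lemma psdmx_ptrace a c (X : 'M[C]_(a * c)) : psdmx X -> psdmx (ptrace X).
Proof. by move=> pX; apply: psdmx_sum => k _; apply: psdmx_mxsub. Qed.

Lemma density_ptrace a c (X : 'M[C]_(a * c)) : density X -> density (ptrace X).
Proof.
by move=> [pX tX]; split; [apply: psdmx_ptrace | rewrite mxtrace_ptrace].
Qed.

(** Complete positivity is applied with a one-dimensional ancilla, which the partial trace then
    removes without a cast between [a * 1] and [a]. *)
Lemma completely_positive_psdmx a b (N : {linear 'M[C]_a -> 'M[C]_b}) X :
  completely_positive N -> psdmx X -> psdmx (N X).
Proof.
move=> cpN pX; have := cpN 1%N (X *t 1%:M) (psdmx_tens pX (@psdmx1 _ _)).
rewrite tensmapE => /psdmx_ptrace.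
by rewrite ptrace_tens mxtrace1 scale1r.
Qed.

Lemma channel_density a b (N : {linear 'M[C]_a -> 'M[C]_b}) rho :
  quantum_channel N -> density rho -> density (N rho).
Proof.
move=> [cpN tpN] [prho trho]; split; last by rewrite tpN.
exact: completely_positive_psdmx.
Qed.

(** With [(N (x) id) rho = \sum_j p_j P_j (x) Q_j], tracing out the second factor gives
    [N (ptrace rho) = \sum_j p_j P_j]. The difference is then [\sum_j p_j P_j (x) (Z - M Q_j)],
    positive term by term. *)
Lemma entanglement_breaking_le a b c d (N : {linear 'M[C]_a -> 'M[C]_b})
    (M : {linear 'M[C]_c -> 'M[C]_d}) (Z : 'M[C]_d) rho :
  entanglement_breaking N ->
  (forall sigma, density sigma -> psdmx (Z - M sigma)) -> psdmx rho ->
  psdmx (N (ptrace rho) *t Z - tensmap N M rho).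
Proof.
move=> ebN MZ /(ebN c)[k [p [P [Q [p0 Ppure Qpure defX]]]]].
rewrite tensmap_comp -ptrace_tensmap defX [ptrace _]linear_sum.
rewrite [tensmap _ _ _]linear_sum /= tensmx_suml -sumrB.
apply: psdmx_sum => j _.
rewrite [ptrace _]linearZ [tensmap _ _ _]linearZ /=.
rewrite ptrace_tens tensmapE tensmxZl -scalerBr.
have [pP tP] := density_pure (Ppure j).
have [pQ tQ] := density_pure (Qpure j).
rewrite tQ scale1r -tensmxBr; apply: psdmxZ; first by rewrite ler0c.
by apply: psdmx_tens => //; apply/MZ/density_pure.
Qed.

(* [t^-1 * Tr_D (E_y (1 (x) Z))], where [t = \tr Z], is the measurement that
   implements [E_y] on [B] when the system [D] is prepared in the state
   [Z / t]. *)
Lemma povm_ptrace b d k (E : 'I_k -> 'M[C]_(b * d)) (Z : 'M[C]_d) :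
  povm E -> psdmx Z -> 0 < \tr Z ->
  povm (fun y => (\tr Z)^-1 *: ptrace (E y *m (1%:M *t Z))).
Proof.
move=> [pE sE] pZ tZ; split=> [y|]; last first.
  rewrite -scaler_sumr -linear_sum /= -mulmx_suml sE mul1mx ptrace_tens.
  by rewrite scalerA mulVf ?scale1r // gt_eqF.
apply: psdmxZ; first by rewrite invr_ge0 ltW.
move=> v; rewrite form_mxE -ptrace_mulr mxtrace_ptrace -mulmxA tensmx_mul.
rewrite mul1mx mulmx1; apply: tr_psdmxM_ge0 => //.
by apply: psdmx_tens => //; apply: psdmx_gram.
Qed.

Lemma tr_ptrace_povm b d (E : 'M[C]_(b * d)) (Z : 'M[C]_d) (X : 'M[C]_b) :
  \tr (ptrace (E *m (1%:M *t Z)) *m X) = \tr (E *m (X *t Z)).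
Proof.
by rewrite -ptrace_mulr mxtrace_ptrace -mulmxA tensmx_mul mul1mx mulmx1.
Qed.

End PositiveMaps.

(** * Real parts of complex numbers *)

Section ComplexRe.
Variable R : rcfType.
Implicit Types z w : R[i].

Lemma ReD z w : complex.Re (z + w) = complex.Re z + complex.Re w.
Proof. by case: z w => [? ?] []. Qed.

Lemma ReN z : complex.Re (- z) = - complex.Re z.
Proof. by case: z. Qed.

Lemma Re_nat m : complex.Re (m%:R : R[i]) = m%:R.
Proof. by rewrite -[m%:R in LHS](rmorph_nat (real_complex R)). Qed.

Lemma Re_sum (I : Type) (r : seq I) (P : pred I) (F : I -> R[i]) :
  complex.Re (\sum_(i <- r | P i) F i) = \sum_(i <- r | P i) complex.Re (F i).
Proof. exact: (big_morph _ ReD). Qed.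

Lemma Re_le z w : z <= w -> complex.Re z <= complex.Re w.
Proof. by rewrite lecE => /andP[]. Qed.

Lemma Re_realM (t : R) z : complex.Re (t%:C%C * z) = t * complex.Re z.
Proof. by case: z => ? ? /=; rewrite mul0r subr0. Qed.

Lemma ge0_ReK z : 0 <= z -> (complex.Re z)%:C%C = z.
Proof. by move=> z0; apply/RRe_real/ger0_real. Qed.

End ComplexRe.

(** * Classical communication value as an optimum over decoders *)

Section ClassicalCv.
Variables (R : realType) (n n' : nat) (P : 'I_n -> 'I_n' -> R).

Lemma classical_cv_ge0 : 0 <= classical_cv P.
Proof. by apply: sumr_ge0 => y _; apply: bigmax_ge_id. Qed.

Lemma sum_le_classical_cv (f : 'I_n' -> 'I_n) :
  \sum_y P (f y) y <= classical_cv P.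
Proof. by apply: ler_sum => y _; apply: le_bigmax. Qed.

(** The maximum-likelihood decoder attains the value. Nonnegativity of [P] keeps the default 0 of
    the maximum from exceeding every entry. *)
Lemma classical_cv_le_sum : (0 < n)%N -> (forall x y, 0 <= P x y) ->
  exists f : 'I_n' -> 'I_n, classical_cv P <= \sum_y P (f y) y.
Proof.
move=> n0 P0; exists (fun y => [arg max_(x > Ordinal n0) P x y]%O).
apply: ler_sum => y _; case: arg_maxP => //= x _ xmax.
by apply: bigmax_le => // x' _; apply: xmax.
Qed.

End ClassicalCv.

(** * Basic properties of the communication value *)

Section CommunicationValue.
Variable R : realType.
Local Notation C := R[i].

Definition cv_values a b (N : {linear 'M[C]_a -> 'M[C]_b}) : set R :=
  [set r : R | exists (n n' : nat)
        (rho : 'I_n -> 'M[C]_a) (E : 'I_n' -> 'M[C]_b),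
        [/\ (0 < n)%N, forall x, density (rho x), povm E &
            r = classical_cv (transition N rho E)]]%classic.

Section OneChannel.
Variables (a b : nat) (N : {linear 'M[C]_a -> 'M[C]_b}).

Lemma density_dim_gt0 (rho : 'M[C]_a) : density rho -> (0 < a)%N.
Proof.
case: a rho => // rho [_]; rewrite /mxtrace big_ord0 => /eqP.
by rewrite eq_sym oner_eq0.
Qed.

Lemma cv_dim0 : a = 0%N -> cv N = 0.
Proof.
move=> a0; rewrite /cv -[RHS](@sup0 R); congr sup.
rewrite -subset0 => r [n [n' [rho [E [n0 drho _ _]]]]].
by have := density_dim_gt0 (drho (Ordinal n0)); rewrite a0.
Qed.

Lemma cv_ge0 : 0 <= cv N.
Proof.
(* A set without a supremum has [sup] equal to 0 by convention. *)
have [hs|/sup_out] := pselect (has_sup (cv_values N)); last first.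
  by rewrite /cv => ->.
have [[r Nr] ub] := hs; apply: le_trans (ub_le_sup ub Nr).
by case: Nr => n [n' [rho [E [_ _ _ ->]]]]; apply: classical_cv_ge0.
Qed.

Lemma classical_cv_le_cv n n' (rho : 'I_n -> 'M[C]_a) (E : 'I_n' -> 'M[C]_b) :
  has_ubound (cv_values N) -> (0 < n)%N -> (forall x, density (rho x)) ->
  povm E -> classical_cv (transition N rho E) <= cv N.
Proof.
by move=> ub n0 drho pE; apply: ub_le_sup => //; exists n, n', rho, E.
Qed.

Hypothesis chN : quantum_channel N.

Lemma transitionC n n' (rho : 'I_n -> 'M[C]_a) (E : 'I_n' -> 'M[C]_b) x y :
  density (rho x) -> povm E ->
  (transition N rho E x y)%:C%C = \tr (E y *m N (rho x)).
Proof.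
move=> drho [pE _]; apply/ge0_ReK/tr_psdmxM_ge0; first exact: pE.
by have [] := channel_density chN drho.
Qed.

Lemma transition_ge0 n n' (rho : 'I_n -> 'M[C]_a) (E : 'I_n' -> 'M[C]_b) x y :
  density (rho x) -> povm E -> 0 <= transition N rho E x y.
Proof.
move=> drho pE; rewrite -ler0c transitionC //; apply: tr_psdmxM_ge0.
  exact: pE.1.
by have [] := channel_density chN drho.
Qed.

(** Since [N rho <= 1] for a density [rho], outcome [y] contributes at most [\tr (E y)], and these
    traces add up to [\tr 1 = b]. *)
Lemma cv_values_bounded : has_ubound (cv_values N).
Proof.
exists b%:R => r [n [n' [rho [E [n0 drho pE ->]]]]].
have [f /le_trans-> //] := classical_cv_le_sum n0
  (fun x y => transition_ge0 y (drho x) pE).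
have -> : b%:R = \sum_y complex.Re (\tr (E y)).
  by rewrite -Re_sum -raddf_sum pE.2 /= mxtrace1 Re_nat.
apply: ler_sum => y _; apply: Re_le; rewrite -subr_ge0 -raddfB.
rewrite -{1}[E y]mulmx1 -mulmxBr; apply: tr_psdmxM_ge0; first exact: pE.1.
exact/density_le1/channel_density.
Qed.

Lemma cv_values_nonempty : (0 < a)%N -> (cv_values N !=set0)%classic.
Proof.
case: a N => // a' N' _.
exists (classical_cv (transition N' (fun _ : 'I_1 => delta_mx 0 0)
  (fun _ : 'I_1 => 1%:M))).
exists 1%N, 1%N, (fun _ => delta_mx 0 0), (fun _ => 1%:M).
split=> // [_|]; first exact: density_delta.
by split=> [y|]; [apply: psdmx1 | rewrite big_ord1].
Qed.

End OneChannel.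
End CommunicationValue.

(** * Perturbing a measurement along a rank-one projection *)

(* Replacing each [E y] by [A *m E y *m A] and adding the outcome
   [e * (2 - e) *: K] turns a measurement into a measurement. *)
Section Perturbation.
Variables (R : rcfType) (n : nat).
Local Notation C := R[i].
Variables (v : 'cV[C]_n) (e : C).
Hypothesis e_ge0 : 0 <= e.
Let K := v *m adjmx v.
Let A : 'M[C]_n := 1%:M - e *: K.

Let adjA : adjmx A = A.
Proof.
by rewrite adjmxB adjmx1 adjmxZ adjmxM adjmxK conj_Creal // ger0_real.
Qed.

Lemma perturbed_psdmx (E : 'M[C]_n) : psdmx E -> psdmx (A *m E *m A).
Proof. by move=> pE; rewrite -{2}adjA; apply: psdmx_conj. Qed.

Lemma perturbed_tr (E s : 'M[C]_n) : psdmx E -> psdmx s ->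
  \tr (E *m s) - e * (\tr (E *m s *m K) + \tr (s *m E *m K)) <=
  \tr (A *m E *m A *m s).
Proof.
move=> pE ps.
have KEs : \tr (K *m E *m s) = \tr (E *m s *m K).
  by rewrite -mulmxA mxtrace_mulC.
have EKs : \tr (E *m K *m s) = \tr (s *m E *m K).
  by rewrite mxtrace_mulC mulmxA.
have KEKs : 0 <= \tr (K *m E *m K *m s).
  apply: tr_psdmxM_ge0 => //.
  by have := psdmx_conj K pE; rewrite {2}/K adjmxM adjmxK.
have -> : A *m E *m A *m s = E *m s - e *: (K *m E *m s)
    - e *: (E *m K *m s) + (e * e) *: (K *m E *m K *m s).
  rewrite /A !(mulmxBl, mulmxBr, mul1mx, mulmx1, scalemxAl).
  rewrite -!(scalemxAl, scalemxAr) scalerA.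
  by rewrite opprB addrA addrAC.
(* The second-order term [e * e * \tr (K *m E *m K *m s)] is nonnegative and is dropped. *)
rewrite !mxtraceD !raddfN /= !mxtraceZ KEs EKs mulrDr opprD addrA.
by rewrite lerDl !mulr_ge0.
Qed.

Lemma perturbed_sum : (adjmx v *m v) 0 0 = 1 ->
  A *m A + (e * (2 - e)) *: K = 1%:M.
Proof.
move=> v1; have KK : K *m K = K by apply: proj_idem.
rewrite /A mulmxBl mul1mx mulmxBr mulmx1 -scalemxAl -scalemxAr KK.
apply/matrixP => i j; rewrite !mxE; ring.
Qed.
End Perturbation.

(** * Nearly optimal dual operators *)

Section Duality.
Variables (R : realType) (a b : nat).
Local Notation C := R[i].
Variable N : {linear 'M[C]_a -> 'M[C]_b}.
Hypothesis chN : quantum_channel N.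

(** The left side bounds from below the value of the perturbed protocol, in which the new outcome is
    decoded as [sigma]: the old outcomes lose at most the term linear in [e], and the new one
    contributes the last term. *)
Lemma cv_perturbed n' (rho : 'I_n' -> 'M[C]_a) (E : 'I_n' -> 'M[C]_b)
    (sigma : 'M[C]_a) (v : 'cV[C]_b) (e : R) :
  0 < e <= 1 -> (forall y, density (rho y)) -> povm E -> density sigma ->
  (adjmx v *m v) 0 0 = 1 ->
  \sum_y transition N rho E y y -
    e * (\sum_y complex.Re (\tr (E y *m N (rho y) *m (v *m adjmx v)) +
                            \tr (N (rho y) *m E y *m (v *m adjmx v)))) +
    e * (2 - e) * complex.Re (\tr (N sigma *m (v *m adjmx v))) <= cv N.
Proof.
move=> /andP[e0 e1] drho pE dsigma v1; set K := v *m adjmx v.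
pose z y := \tr (E y *m N (rho y) *m K) + \tr (N (rho y) *m E y *m K).
have eC_ge0 : 0 <= e%:C%C by rewrite ler0c ltW.
pose A := 1%:M - e%:C%C *: K.
(* For the projection [K] one has [1 - A *m A = t *: K], which is the share left for the new
   outcome. *)
pose t := e%:C%C * (2 - e%:C%C).
have tE : t = (e * (2 - e))%:C%C by rewrite rmorphM rmorphB rmorph_nat.
have t_ge0 : 0 <= t by rewrite tE ler0c mulr_ge0 ?subr_ge0 ?ltW //; lra.
(* Index 0 carries the new state and outcome; the old ones are shifted by one. *)
pose rho' (y : 'I_n'.+1) := oapp rho sigma (unlift ord0 y).
pose E' (y : 'I_n'.+1) :=
  oapp (fun y => A *m E y *m A) (t *: K) (unlift ord0 y).
have drho' y : density (rho' y) by rewrite /rho'; case: unlift => /=.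
have pE' : povm E'.
  split=> [y|].
    rewrite /E'; case: unlift => [y'|] /=.
      by apply: perturbed_psdmx => //; apply: pE.1.
    by apply: psdmxZ => //; apply: psdmx_gram.
  rewrite big_ord_recl /E' unlift_none /=.
  under eq_bigr => y _ do rewrite liftK /=.
  by rewrite -mulmx_suml -mulmx_sumr pE.2 mulmx1 addrC perturbed_sum.
have ub := cv_values_bounded chN.
apply: le_trans (classical_cv_le_cv ub (ltn0Sn n') drho' pE').
apply: le_trans (sum_le_classical_cv _ id).
rewrite big_ord_recl [X in _ <= X + _]/transition /E' /rho' unlift_none.
rewrite /= addrC.
rewrite -scalemxAl mxtraceZ tE Re_realM [\tr (K *m _)]mxtrace_mulC lerD2l.
rewrite mulr_sumr -sumrB; apply: ler_sum => y _.
rewrite /transition liftK /= -Re_realM -ReN -ReD.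
apply: Re_le; apply: perturbed_tr => //; first exact: pE.1.
by have [] := channel_density chN (drho y).
Qed.

(* The witness is the symmetrised operator [\sum_y E y *m N (rho y)] of a nearly
   optimal protocol; perturbing the measurement along a vector [v] cannot
   improve the protocol much, which is the operator inequality tested on [v]. *)
Lemma cv_dual (e : R) : (0 < a)%N -> 0 < e <= 1 ->
  exists2 Z : 'M[C]_b,
    forall sigma, density sigma -> psdmx (Z - N sigma) &
    complex.Re (\tr Z) <= cv N + e * b%:R.
Proof.
move=> a0 e01; have /andP[e0 e1] := e01.
have ub := cv_values_bounded chN.
(* The protocol is optimal up to [e * e]: the perturbation inequality is divided by [e] at the end,
   which leaves an error of order [e]. *)
have [r [n [n' [rho [E [n0 drho pE ->]]]]] cvr] :=
  sup_adherent (mulr_gt0 e0 e0) (conj (cv_values_nonempty N a0) ub).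
have [f rf] := classical_cv_le_sum n0
  (fun x y => transition_ge0 chN y (drho x) pE).
have {cvr} cvf := lt_le_trans cvr rf.
pose s y := N (rho (f y)).
have ds y : density (s y) by apply: channel_density.
pose G : 'M[C]_b := 2^-1 *: \sum_y (E y *m s y + s y *m E y).
(* The shift by [e] absorbs that error and costs [e * b] in the trace. *)
exists (G + e%:C%C%:M) => [sigma dsigma|]; last first.
  rewrite mxtraceD mxtrace_scalar mxtraceZ raddf_sum.
  under eq_bigr => y _ do
    rewrite /= mxtraceD [X in _ + X]mxtrace_mulC -mulr2n -mulr_natl.
  rewrite -mulr_sumr mulrA mulVf ?pnatr_eq0 // mul1r ReD Re_sum.
  apply: lerD; last first.
    by rewrite -[_%:C%C *+ b]mulr_natr Re_realM Re_nat.
  apply: le_trans (classical_cv_le_cv ub n0 drho pE).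
  exact: (sum_le_classical_cv (transition N rho E) f).
apply: psdmx_unit => v v1.
pose z y := \tr (E y *m s y *m (v *m adjmx v)) +
  \tr (s y *m E y *m (v *m adjmx v)).
(* The two traces in [z y] are complex conjugates of each other. *)
have zR y : (complex.Re (z y))%:C%C = z y.
  apply/RRe_real/CrealP; rewrite rmorphD /= -!tr_adjmx !adjmxM adjmxK.
  rewrite (psdmx_adj (pE.1 y)) (psdmx_adj (ds y).1) addrC.
  by rewrite [in LHS]mxtrace_mulC [X in _ + X]mxtrace_mulC.
set k := \tr (N sigma *m (v *m adjmx v)).
have k_ge0 : 0 <= k.
  apply: tr_psdmxM_ge0; last exact: psdmx_gram.
  by have [] := channel_density chN dsigma.
have kR := ge0_ReK k_ge0.
have k_le1 : complex.Re k <= 1.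
  exact: (Re_le (tr_proj_density_le1 (channel_density chN dsigma) v1)).
have -> : (adjmx v *m (G + e%:C%C%:M - N sigma) *m v) 0 0 =
    (2^-1 * (\sum_y complex.Re (z y)) + e - complex.Re k)%:C%C.
  rewrite form_mxE mulmxBl mulmxDl mul_scalar_mx raddfB raddfD /= -/k.
  rewrite [\tr (_ *: (_ *m _))]mxtraceZ [\tr (v *m _)]mxtrace_mulC trace_mx11.
  rewrite v1 mulr1 rmorphB rmorphD rmorphM fmorphV rmorph_nat rmorph_sum /= kR.
  congr (_ + _ - _); rewrite -scalemxAl mxtraceZ mulmx_suml raddf_sum.
  by congr (_ * _); apply: eq_bigr => y _; rewrite zR /= mulmxDl mxtraceD.
rewrite ler0c; have := cv_perturbed e01 (fun y => drho (f y)) pE dsigma v1.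
rewrite /= -/k => H.
have {}H : \sum_y transition N rho E (f y) y - e * (\sum_y complex.Re (z y)) +
  e * (2 - e) * complex.Re k <= cv N by apply: H.
(* Near-optimality and [H] leave a remainder [e * e * (1 - k)], nonnegative because [k <= 1]. *)
have key : 0 < e * (\sum_y complex.Re (z y) + 2 * e - 2 * complex.Re k).
  have : 0 <= (1 - complex.Re k) * (e * e).
    by rewrite !mulr_ge0 ?subr_ge0 // ltW.
  by rewrite -/(cv N) in cvf; nra.
by move: key; rewrite pmulr_rgt0 //; lra.
Qed.

End Duality.

(** * Lower and upper bounds for the product channel *)

Section Multiplicativity.
Variables (R : realType) (a b c d : nat).
Local Notation C := R[i].
Variables (N : {linear 'M[C]_a -> 'M[C]_b}) (M : {linear 'M[C]_c -> 'M[C]_d}).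
Hypotheses (chN : quantum_channel N) (chM : quantum_channel M).

Lemma cv_values_mul_le r1 r2 : has_ubound (cv_values (tensmap N M)) ->
  cv_values N r1 -> cv_values M r2 -> r1 * r2 <= cv (tensmap N M).
Proof.
move=> ub [n1 [n1' [rho1 [E1 [n10 drho1 pE1 ->]]]]].
move=> [n2 [n2' [rho2 [E2 [n20 drho2 pE2 ->]]]]].
have [f1 le1] := classical_cv_le_sum n10
  (fun x y => transition_ge0 chN y (drho1 x) pE1).
have [f2 le2] := classical_cv_le_sum n20
  (fun x y => transition_ge0 chM y (drho2 x) pE2).
pose rho (x : 'I_(n1 * n2)) :=
  rho1 (mxtens_unindex x).1 *t rho2 (mxtens_unindex x).2.
pose E (y : 'I_(n1' * n2')) :=
  E1 (mxtens_unindex y).1 *t E2 (mxtens_unindex y).2.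
(* Decoding the two components separately makes the success sum factor. *)
pose f (y : 'I_(n1' * n2')) :=
  mxtens_index (f1 (mxtens_unindex y).1, f2 (mxtens_unindex y).2).
have n12 : (0 < n1 * n2)%N by rewrite muln_gt0 n10.
have drho x : density (rho x) by apply: density_tens.
have pE : povm E.
  split=> [y|]; first by apply: psdmx_tens; [apply: pE1.1 | apply: pE2.1].
  rewrite sum_mxtens -tensmx11 -pE1.2 tensmx_suml; apply: eq_bigr => i _.
  rewrite -pE2.2 tensmx_sumr; apply: eq_bigr => j _.
  by rewrite /E mxtens_indexK.
apply: le_trans (ler_pM (classical_cv_ge0 _) (classical_cv_ge0 _) le1 le2) _.
apply: le_trans (classical_cv_le_cv ub n12 drho pE).
apply: le_trans (sum_le_classical_cv _ f).
rewrite mulr_sum; apply: ler_sum => y _.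
rewrite [leRHS]/transition /E /rho /f mxtens_indexK /= tensmapE tensmx_mul.
rewrite mxtrace_tens -(transitionC chN _ (drho1 _) pE1).
by rewrite -(transitionC chM _ (drho2 _) pE2) Re_realM.
Qed.

(** Domination replaces the output by [N (ptrace rho) (x) Z]; measuring this with [E] amounts, up to
    the factor [\tr Z], to measuring [N (ptrace rho)] with the POVM of [povm_ptrace]. *)
Lemma cv_values_le_dual (Z : 'M[C]_d) r :
  entanglement_breaking N ->
  (forall sigma, density sigma -> psdmx (Z - M sigma)) ->
  cv_values (tensmap N M) r -> r <= complex.Re (\tr Z) * cv N.
Proof.
move=> ebN MZ [n [n' [rho [E [n0 drho pE ->]]]]].
have c0 : (0 < c)%N.
  have := density_dim_gt0 (drho (Ordinal n0)).
  by rewrite muln_gt0 => /andP[].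
have [sigma dsigma] : exists sigma : 'M[C]_c, density sigma.
  by case: (c) c0 => // c' _; exists (delta_mx 0 0); apply: density_delta.
have [pMs tMs] := channel_density chM dsigma.
have pZ : psdmx Z.
  by rewrite -(subrK (M sigma) Z); apply: psdmxD => //; apply: MZ.
(* [Z] dominates the density operator [M sigma], so its trace is at least 1. *)
have tZ : 0 < \tr Z.
  apply: lt_le_trans ltr01 _; rewrite -tMs -subr_ge0 -raddfB.
  exact/psdmx_tr_ge0/MZ.
have tZR := ge0_ReK (ltW tZ).
have pF := povm_ptrace pE pZ tZ.
have drhoA x : density (ptrace (rho x)) by apply: density_ptrace.
have ReZ : 0 <= complex.Re (\tr Z) by rewrite -ler0c tZR ltW.
apply: le_trans (ler_wpM2l ReZ
  (classical_cv_le_cv (cv_values_bounded chN) n0 drhoA pF)).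
rewrite mulr_sumr; apply: ler_sum => y _; apply: bigmax_le => [|x _].
  by rewrite mulr_ge0 // bigmax_ge_id.
apply: le_trans (ler_wpM2l ReZ (le_bigmax _ _ x)).
rewrite -Re_realM tZR; apply: Re_le.
rewrite -scalemxAl mxtraceZ mulVKf ?gt_eqF // tr_ptrace_povm -subr_ge0 -raddfB.
rewrite -mulmxBr; apply: tr_psdmxM_ge0; first exact: pE.1.
exact: entanglement_breaking_le (drho x).1.
Qed.

Lemma cv_values_le_mul r : entanglement_breaking N ->
  cv_values (tensmap N M) r -> r <= cv N * cv M.
Proof.
move=> ebN rV; have c0 : (0 < c)%N.
  case: rV => n [n' [rho [_ [n0 drho _ _]]]].
  have := density_dim_gt0 (drho (Ordinal n0)).
  by rewrite muln_gt0 => /andP[].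
apply/ler_addgt0Pr => t t0.
have K0 : 0 <= d%:R * cv N by rewrite mulr_ge0 ?cv_ge0.
have K1 : 0 < d%:R * cv N + 1 by rewrite ltr_wpDl.
(* Chosen so that the excess [e * d * cv N] is at most [t]; the [+ 1] keeps the denominator positive
   when [cv N = 0]. *)
pose e := Num.min 1 (t / (d%:R * cv N + 1)).
have e01 : 0 < e <= 1 by rewrite lt_min ltr01 divr_gt0 //= ge_min lexx.
have [Z MZ trZ] := cv_dual chM c0 e01.
apply: le_trans (cv_values_le_dual ebN MZ rV) _.
apply: le_trans (ler_wpM2r (cv_ge0 N) trZ) _.
rewrite mulrDl [cv M * _]mulrC lerD2l -mulrA.
have eK : e * (d%:R * cv N + 1) <= t.
  by rewrite -ler_pdivlMr // ge_min lexx orbT.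
have /andP[e0 _] := e01; lra.
Qed.

End Multiplicativity.

Theorem theorem3 (R : realType) (a b c d : nat)
    (N : {linear 'M[R[i]]_a -> 'M[R[i]]_b})
    (M : {linear 'M[R[i]]_c -> 'M[R[i]]_d}) :
  quantum_channel N -> entanglement_breaking N -> quantum_channel M ->
  cv (tensmap N M) = cv N * cv M.
Proof.
move=> chN ebN chM.
(* With a zero-dimensional input, both sides take the default value 0. *)
have [a0|a0] := posnP a; first by rewrite [cv N]cv_dim0 // mul0r cv_dim0 // a0.
have [c0|c0] := posnP c.
  by rewrite [cv M]cv_dim0 // mulr0 cv_dim0 // c0 muln0.
(* The upper bound itself supplies boundedness, so complete positivity of [tensmap N M] need not be
   established. *)
have ubNM : has_ubound (cv_values (tensmap N M)).
  by exists (cv N * cv M) => r; apply: cv_values_le_mul.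
apply/le_anti/andP; split.
  apply: ge_sup; last by move=> r; apply: cv_values_le_mul.
  by apply: cv_values_nonempty; rewrite muln_gt0 a0.
(* Suprema are taken one factor at a time, dividing by the other factor when it is positive;
   otherwise the product is at most 0. *)
have mulP r1 r2 := @cv_values_mul_le _ _ _ _ _ _ _ chN chM r1 r2 ubNM.
have cvNr r : cv_values N r -> r * cv M <= cv (tensmap N M).
  move=> Nr; have [r0|r0] := leP r 0.
    by apply: le_trans (cv_ge0 _); rewrite mulr_le0_ge0 ?cv_ge0.
  rewrite mulrC -ler_pdivlMr //; apply: ge_sup; first exact: cv_values_nonempty.
  by move=> r2 Mr2; rewrite ler_pdivlMr // mulrC mulP.
have [M0|M0] := leP (cv M) 0.
  by apply: le_trans (cv_ge0 _); rewrite mulr_ge0_le0 ?cv_ge0.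
rewrite -ler_pdivlMr //; apply: ge_sup; first exact: cv_values_nonempty.
by move=> r Nr; rewrite ler_pdivlMr // cvNr.
Qed.
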